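(* There are no fuzzy implication functions that are simultaneously $R_O$-implications and $(\mathcal{GO},N)$-implications.
   Context: A fuzzy negation is a map $N:[0,1]\to[0,1]$ with $N(0)=1$, $N(1)=0$ and $N(x)\le N(y)$ whenever $y\le x$. A bivariate general overlap function is a function $\mathcal{GO}:[0,1]^2\to[0,1]$ such that for all $x,y\in[0,1]$: (1) $\mathcal{GO}(x,y)=\mathcal{GO}(y,x)$; (2) if $xy=0$ then $\mathcal{GO}(x,y)=0$; (3) if $xy=1$ then $\mathcal{GO}(x,y)=1$; (4) $\mathcal{GO}$ is increasing (in the non-strict sense) in each variable; (5) $\mathcal{GO}$ is continuous. An overlap function is a function $O:[0,1]^2\to[0,1]$ that is commutative, continuous, increasing (in the non-strict sense) in each variable, and satisfies $O(x,y)=0$ if and only if $x=0$ or $y=0$, and $O(x,y)=1$ if and only if $x=y=1$. A fuzzy implication is a function $I:[0,1]^2\to[0,1]$ such that for all $x,y,z\in[0,1]$: $x\le z$ implies $I(x,y)\ge I(z,y)$; $y\le z$ implies $I(x,y)\le I(x,z)$; $I(0,y)=1$; $I(x,1)=1$; $I(1,0)=0$. A $(\mathcal{GO},N)$-implication is a function $I$ for which there exist a bivariate general overlap function $\mathcal{GO}$ and a fuzzy negation $N$ with $I(x,y)=N(\mathcal{GO}(x,N(y)))$ for all $x,y\in[0,1]$. An $R_O$-implication is a function $I$ for which there exists an overlap function $O$ with $I(x,y)=\max\{z\in[0,1] : O(x,z)\le y\}$ for all $x,y\in[0,1]$. *)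

(* Defs.v *)
From HB Require Import structures.
From mathcomp Require Import all_boot all_order all_algebra.
From mathcomp Require Import all_classical all_reals all_analysis.

Set Implicit Arguments.
Unset Strict Implicit.
Unset Printing Implicit Defensive.
Import Order.TTheory GRing.Theory Num.Theory.
Import numFieldNormedType.Exports.

Local Open Scope classical_set_scope.
Local Open Scope ring_scope.

(* A map [0,1] -> [0,1] or [0,1]^2 -> [0,1] is encoded as a function on all of R
   (resp. R^2) that preserves the unit interval; each condition below only
   constrains its values at points of the unit interval. *)
Section FuzzyConnectives.
Context {R : realType}.
Implicit Types (x y z : R) (N : R -> R) (f GO O I : R -> R -> R).

Definition unit_map N : Prop :=
  forall x, x \in `[0, 1] -> N x \in `[0, 1].

Definition unit_map2 f : Prop :=
  forall x y, x \in `[0, 1] -> y \in `[0, 1] -> f x y \in `[0, 1].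

Definition unit_commutative f : Prop :=
  forall x y, x \in `[0, 1] -> y \in `[0, 1] -> f x y = f y x.

Definition unit_increasing f : Prop :=
  (forall x y z, x \in `[0, 1] -> y \in `[0, 1] -> z \in `[0, 1] ->
     x <= z -> f x y <= f z y) /\
  (forall x y z, x \in `[0, 1] -> y \in `[0, 1] -> z \in `[0, 1] ->
     y <= z -> f x y <= f x z).

(* Joint continuity, for the topology induced on the unit square. *)
Definition unit_continuous f : Prop :=
  {within `[0, 1]%classic `*` `[0, 1]%classic,
    continuous (fun p : R * R => f p.1 p.2)}.

Record fuzzy_negation N : Prop := FuzzyNegation {
  fneg_unit : unit_map N;
  fneg0 : N 0 = 1;
  fneg1 : N 1 = 0;
  fneg_anti : forall x y, x \in `[0, 1] -> y \in `[0, 1] ->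
    y <= x -> N x <= N y
}.

Record general_overlap GO : Prop := GeneralOverlap {
  go_unit : unit_map2 GO;
  go_comm : unit_commutative GO;
  go_eq0 : forall x y, x \in `[0, 1] -> y \in `[0, 1] ->
    x * y = 0 -> GO x y = 0;
  go_eq1 : forall x y, x \in `[0, 1] -> y \in `[0, 1] ->
    x * y = 1 -> GO x y = 1;
  go_incr : unit_increasing GO;
  go_cont : unit_continuous GO
}.

Record overlap O : Prop := Overlap {
  ov_unit : unit_map2 O;
  ov_comm : unit_commutative O;
  ov_cont : unit_continuous O;
  ov_incr : unit_increasing O;
  ov_eq0 : forall x y, x \in `[0, 1] -> y \in `[0, 1] ->
    (O x y = 0 <-> x = 0 \/ y = 0);
  ov_eq1 : forall x y, x \in `[0, 1] -> y \in `[0, 1] ->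
    (O x y = 1 <-> x = 1 /\ y = 1)
}.

Record fuzzy_implication I : Prop := FuzzyImplication {
  fimp_unit : unit_map2 I;
  fimp_anti_l : forall x y z,
    x \in `[0, 1] -> y \in `[0, 1] -> z \in `[0, 1] ->
    x <= z -> I x y >= I z y;
  fimp_homo_r : forall x y z,
    x \in `[0, 1] -> y \in `[0, 1] -> z \in `[0, 1] ->
    y <= z -> I x y <= I x z;
  fimp0y : forall y, y \in `[0, 1] -> I 0 y = 1;
  fimpx1 : forall x, x \in `[0, 1] -> I x 1 = 1;
  fimp10 : I 1 0 = 0
}.

Definition GON_implication I : Prop :=
  exists GO N, [/\ general_overlap GO, fuzzy_negation N &
    forall x y, x \in `[0, 1] -> y \in `[0, 1] -> I x y = N (GO x (N y))].

Definition is_maximum (A : set R) (m : R) : Prop := A m /\ ubound A m.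

Definition RO_implication I : Prop :=
  exists O, overlap O /\
    forall x y, x \in `[0, 1] -> y \in `[0, 1] ->
      is_maximum [set z | z \in `[0, 1] /\ O x z <= y] (I x y).

End FuzzyConnectives.

(* Main.v *)
Require Import Defs.
From HB Require Import structures.
From mathcomp Require Import all_boot all_order all_algebra.
From mathcomp Require Import all_classical all_reals all_analysis.

(** Every residual implication [I] of an overlap function satisfies
    [I x 0 = 0] for [x > 0], because an overlap function has no zero divisors.
    If moreover [I x y = N (GO x (N y))], then [y = 0] gives
    [N (GO x 1) = 0] for [x > 0].  The section [GO _ 1] is continuous and goes
    from 0 to 1, so it takes every value [v] of the open unit interval, and
    only away from 0 ([GO_section_surj]).  Hence [N v = 0] for each such [v],
    and [I 1 v = N (GO 1 0) = N 0 = 1] (so [N] is crisp, and [I] with it).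
    Residuation turns [I 1 v = 1] into [O 1 1 <= v < 1], whereas
    [O 1 1 = 1].  One value suffices for the contradiction: [v = 1 / 2]. *)

Set Implicit Arguments.
Unset Strict Implicit.
Unset Printing Implicit Defensive.
Import Order.TTheory GRing.Theory Num.Theory.
Import numFieldNormedType.Exports.

Local Open Scope classical_set_scope.
Local Open Scope ring_scope.

Section Sections.
Context {R : realType}.
Implicit Types (x y v : R) (f GO O I : R -> R -> R).

Lemma mem0_unit : (0 : R) \in `[0, 1].
Proof. by rewrite in_itv /= lexx ler01. Qed.

Lemma mem1_unit : (1 : R) \in `[0, 1].
Proof. by rewrite in_itv /= lexx ler01. Qed.

Lemma unit_continuous_section f y : y \in `[0, 1] -> unit_continuous f ->
  {within `[0, 1]%classic, continuous (f^~ y)}.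
Proof.
move=> y01 /subspace_continuousP cf; apply/subspace_continuousP => x x01.
apply: (@cvg_comp _ _ _ (fun t => (t, y)) (fun p => f p.1 p.2) _
  (within (`[0, 1]%classic `*` `[0, 1]%classic) (nbhs (x, y)))); last first.
  exact: (cf (x, y) (conj x01 y01)).
(* A horizontal segment inside the square meets the square exactly along the
   unit interval, so the pairing is continuous for the two traces. *)
move=> A; rewrite /within /= => nA.
have cpair : (fun t : R => (t, y)) @ x --> (x, y).
  exact: (cvg_pair cvg_id (cvg_cst y)).
have nAy : \forall t \near x,
    (`[0, 1]%classic `*` `[0, 1]%classic) (t, y) -> A (t, y).
  exact: cpair _ nA.
by move: nAy; apply: filterS => t /= At t01; apply: At; split.
Qed.

(** The intermediate value theorem for the section [GO _ 1], which runs
    from 0 at 0 to 1 at 1. *)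
Lemma GO_section_surj GO v : general_overlap GO -> v \in `[0, 1] ->
  exists2 x, x \in `[0, 1] & GO x 1 = v.
Proof.
move=> hGO; rewrite in_itv /= => v01.
apply: (IVT ler01 (unit_continuous_section mem1_unit (go_cont hGO))).
rewrite (go_eq0 hGO mem0_unit mem1_unit (mul0r 1)).
rewrite (go_eq1 hGO mem1_unit mem1_unit (mul1r 1)).
by rewrite (min_l ler01) (max_r ler01).
Qed.

(** The maximum defining [I x 0] ranges over the [z] with [O x z = 0], and an
    overlap function has no zero divisors. *)
Lemma residuum_x0 O I x : overlap O ->
  (forall x y, x \in `[0, 1] -> y \in `[0, 1] ->
     is_maximum [set z | z \in `[0, 1] /\ O x z <= y] (I x y)) ->
  x \in `[0, 1] -> x <> 0 -> I x 0 = 0.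
Proof.
move=> hO hI x01 x0; have [[I01 OI0] _] := hI x 0 x01 mem0_unit.
have Oge0 : 0 <= O x (I x 0).
  by have := ov_unit hO x01 I01; rewrite in_itv => /andP[].
have OI : O x (I x 0) = 0 by apply/eqP; rewrite eq_le OI0 Oge0.
by case: ((ov_eq0 hO x01 I01).1 OI).
Qed.

End Sections.

Theorem proposition25 (R : realType) :
  ~ exists I : R -> R -> R,
      [/\ fuzzy_implication I, RO_implication I & GON_implication I].
Proof.
move=> [I [_ [ O [hO hI]] [GO [N [hGO hN IE]]]]].
have half_lt1 : (2^-1 : R) < 1 by rewrite invf_lt1 ?ltr1n ?ltr0n.
have half01 : (2^-1 : R) \in `[0, 1].
  by rewrite in_itv /= invr_ge0 ler0n ltW.
have [x x01 GOx] := GO_section_surj hGO half01.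
have x0 : x <> 0.
  move=> x0; move: GOx; rewrite x0 (go_eq0 hGO mem0_unit mem1_unit (mul0r 1)).
  by move/esym/eqP; rewrite invr_eq0 pnatr_eq0.
have Nhalf : N 2^-1 = 0.
  by rewrite -GOx -(fneg0 hN) -IE ?mem0_unit // (residuum_x0 hO hI).
have I1half : I 1 2^-1 = 1.
  rewrite IE ?mem1_unit // Nhalf.
  by rewrite (go_eq0 hGO mem1_unit mem0_unit (mulr0 1)) (fneg0 hN).
have [[_ O11] _] := hI 1 2^-1 mem1_unit half01.
move: O11; rewrite I1half (ov_eq1 hO mem1_unit mem1_unit).2 //.
by rewrite leNgt half_lt1.
Qed.
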